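(* Let $G$ be a connected graph on $n$ vertices with $V(G)=\{1,\ldots,n\}$. Suppose that $1\le k\le n-1$, and define $S_1=\{1,\ldots,k\}$, $S_2=\{k+1,\ldots,n\}$ and $\mathcal{S}=S_1\cup S_2$. For each $i=1,\ldots,n$, let $\delta_{i,1}$ be the number of neighbours of vertex $i$ in $S_1$, and let $\delta_{i,2}$ be the number of neighbours of vertex $i$ in $S_2$. Suppose that $\alpha\in(0,\pi/2)$ and that $\theta_j$ ($j=1,\ldots,n$) is a solution on $[0,\infty)$ to the frustrated Kuramoto model on $G$ with parameter $\alpha$. Suppose further that: - for all $i,j\in S_1$, $\theta_i(t)-\theta_j(t)\to 0$ as $t\to\infty$; - for all $p,q\in S_2$, $\theta_p(t)-\theta_q(t)\to 0$ as $t\to\infty$; - for some $i\in S_1$ and $p\in S_2$, $\theta_i(t)-\theta_p(t)$ does not converge to $0$ as $t\to\infty$. Then (at least) one of the following holds: 1. the partition $\mathcal{S}$ is an equitable partition of $G$; 2. there are real scalars $\mu_1,\mu_2$ and $r$ such that $$-\delta_{i,1}+\mu_1\delta_{i,2}=r\quad\text{for all } i\in S_1,$$ and $$-\delta_{j,2}+\mu_2\delta_{j,1}=r\quad\text{for all } j\in S_2.$$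
   Context: Graphs are finite, without self-loops or multiple edges; $A=A(G)$ denotes the adjacency matrix of $G$. Frustrated Kuramoto model (with natural frequency $0$ and interaction strength $1$): for a phase frustration parameter $\alpha$, the system $$\theta_i'(t)=\sum_{j=1}^n A_{i,j}\sin(\theta_j(t)-\theta_i(t)-\alpha),\qquad t\ge 0,\quad i=1,\ldots,n,$$ for real-valued functions $\theta_1,\ldots,\theta_n$ on $[0,\infty)$. Equitable partition: a partition of $V(G)$ into disjoint non-empty parts $S_1,\ldots,S_m$ is equitable if the number of neighbours in $S_j$ of a vertex $v\in S_i$ depends only on the choice of the parts $S_i$ and $S_j$ (for all $i,j$, including $i=j$). *)

(* Defs.v *)
From HB Require Import structures.
From mathcomp Require Import all_boot all_order all_algebra.
From mathcomp Require Import all_classical all_reals all_analysis.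

Set Implicit Arguments.
Unset Strict Implicit.
Unset Printing Implicit Defensive.

Import Order.TTheory GRing.Theory Num.Theory.
Import numFieldNormedType.Exports.

Local Open Scope classical_set_scope.
Local Open Scope ring_scope.

(* A finite simple graph on the vertex type T is a symmetric irreflexive
   edge relation e : rel T. *)
Definition simple_graph (T : finType) (e : rel T) : Prop :=
  symmetric e /\ irreflexive e.

Definition connected_graph (T : finType) (e : rel T) : Prop :=
  forall x y : T, connect e x y.

Definition adjacency (R : realType) (n : nat) (e : rel 'I_n) : 'M[R]_n :=
  \matrix_(i, j) (e i j)%:R.

Definition nb_neighbours (T : finType) (e : rel T) (x : T) (S : {set T}) : nat :=
  #|[set y in S | e x y]|.

(* finset.partition includes the requirement that no part is empty. *)
Definition equitable_partition (T : finType) (e : rel T) (P : {set {set T}}) :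
    Prop :=
  finset.partition P [set: T] /\
  forall S S' : {set T}, S \in P -> S' \in P ->
    forall x y : T, x \in S -> y \in S ->
      nb_neighbours e x S' = nb_neighbours e y S'.

(* f' = g on [0, +oo[, where the derivative at the endpoint 0 is the right
   derivative; the values of f on negative reals are irrelevant. *)
Definition derivative_on_halfline (R : realType) (f g : R -> R) : Prop :=
  (forall t : R, 0 < t -> is_derive t 1 f (g t)) /\
  h^-1 * (f h - f 0) @[h --> 0^'+] --> g 0.

Definition frustrated_kuramoto_solution (R : realType) (n : nat)
    (e : rel 'I_n) (alpha : R) (theta : 'I_n -> R -> R) : Prop :=
  forall i : 'I_n, derivative_on_halfline (theta i)
    (fun t => \sum_(j < n)
       adjacency R e i j * sin (theta j t - theta i t - alpha)).

(* The vertices 1, ..., n are represented by the ordinals 0, ..., n - 1, so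
   that {1, ..., k} and {k + 1, ..., n} become the following two sets. *)
Definition first_part (n k : nat) : {set 'I_n} := [set i : 'I_n | (i < k)%N]%SET.

Definition second_part (n k : nat) : {set 'I_n} := [set i : 'I_n | (k <= i)%N]%SET.

(* Main.v *)
Require Import Defs.
From HB Require Import structures.
From mathcomp Require Import all_boot all_order all_algebra.
From mathcomp Require Import all_classical all_reals all_analysis.
From mathcomp Require Import ring lra.
Set Implicit Arguments.
Unset Strict Implicit.
Unset Printing Implicit Defensive.

Import Order.TTheory GRing.Theory Num.Theory.
Import numFieldNormedType.Exports.
Local Open Scope classical_set_scope.
Local Open Scope ring_scope.

(** Choose p in the first part S and q in its complement, and let
    y(t) = theta_q(t) - theta_p(t) - alpha be the phase gap between the two
    clusters.  As phases inside a part merge, the velocity of a vertex i of S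
    is asymptotic to - d_S(i) sin alpha + d_C(i) sin y(t), where d_S and d_C
    count neighbours in S and in its complement C ([velocity_cluster]).  For
    i, j in S the difference theta_i - theta_j tends to 0, so by Barbalat's
    lemma ([barbalat]) the difference of these two expressions tends to 0:

      (d_S(j) - d_S(i)) sin alpha + (d_C(i) - d_C(j)) sin y(t) --> 0

    ([cluster_velocity_gap_cvg0]).  The same holds in C, with the gap
    theta_p - theta_q - alpha = - y - 2 alpha.

    If d_C is constant on S and d_S is constant on C, then, sin alpha being
    nonzero, d_S is constant on S and d_C is constant on C, and the partition
    is equitable.

    Otherwise, exchanging the parts if necessary, d_C(i) <> d_C(j) for some
    i, j in S, and then sin y(t) converges, to mu1 sin alpha say.  So
    cos^2 y(t) converges, hence so does cos y(t) by continuity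
    ([cvg_of_sqr]), and therefore sin(- y(t) - 2 alpha) converges, to
    mu2 sin alpha say.  The displayed limit turns into the constancy on S of
    - d_S + mu1 d_C, with value r1, and on C of - d_C + mu2 d_S, with value r2
    ([degree_relation]).  Finally y' tends to (r2 - r1) sin alpha; since sin y
    and cos y both converge, this limit is 0 ([trig_cvg_derive_cvg0]), so
    r1 = r2.  This is the content of [unequal_cross_degrees_relation]. *)

(** * Real functions near infinity *)

Definition lipschitz_on_pos (R : realType) (K : R) (g : R -> R) : Prop :=
  forall s t : R, 0 < s -> 0 < t -> `|g s - g t| <= K * `|s - t|.

Lemma is_derive_continuous (R : realType) (f : R -> R) (d x : R) :
  is_derive x 1 f d -> {for x, continuous f}.
Proof.
move=> fx; apply/differentiable_continuous/derivable1_diffP.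
exact: ex_derive.
Qed.

Lemma MVT_pos (R : realType) (f df : R -> R) (s t : R) :
    (forall x : R, 0 < x -> is_derive x 1 f (df x)) -> 0 < s -> s < t ->
  exists2 c, s < c < t & f t - f s = df c * (t - s).
Proof.
move=> fdf s0 st.
have [||c] := @MVT R f df s t st.
- by move=> x; rewrite in_itv /= => /andP[sx _]; exact/fdf/(lt_trans s0 sx).
- apply: derivable_within_continuous => x; rewrite in_itv /= => /andP[sx _].
  exact/ex_derive/fdf/(lt_le_trans s0 sx).
- by rewrite in_itv /= => cst E; exists c.
Qed.

Lemma bounded_derive_lipschitz (R : realType) (K : R) (f df : R -> R) :
    (forall x : R, 0 < x -> is_derive x 1 f (df x)) ->
    (forall x, `|df x| <= K) ->
  lipschitz_on_pos K f.
Proof.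
move=> fdf dfK.
suff H s t : 0 < s -> s < t -> `|f t - f s| <= K * `|t - s|.
  move=> s t s0 t0; have [st|ts|<-] := ltgtP s t.
  - by rewrite distrC (distrC s); exact: H.
  - exact: H.
  - by rewrite !subrr !normr0 mulr0.
move=> s0 st; have [c _ ->] := MVT_pos fdf s0 st.
by rewrite normrM ler_wpM2r.
Qed.

Lemma sin_lipschitz (R : realType) (a b : R) :
  `|sin a - sin b| <= `|a - b|.
Proof.
suff H s t : s < t -> `|sin t - sin s| <= `|t - s| :> R.
  have [ab|ba|<-] := ltgtP a b.
  - by rewrite distrC (distrC a); exact: H.
  - exact: H.
  - by rewrite !subrr !normr0.
move=> st; have [|c _ ->] := @MVT R sin cos s t st (fun x _ => is_derive_sin x).
  by apply: continuous_subspaceT => x; exact: continuous_sin.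
by rewrite normrM ler_piMl // ler_norml cos_geN1 cos_le1.
Qed.

(** A quantitative form of Barbalat's lemma.  If g were large at some late
    time t, then by the Lipschitz bound it would stay large on an interval
    [t, t + h] of fixed length, and so would df; but the mean value theorem
    gives a point of that interval where df = (f (t + h) - f t) / h, which is
    small because f converges.  Comparing df with a Lipschitz g avoids any
    regularity assumption on df itself. *)
Lemma barbalat (R : realType) (f df g : R -> R) (K l : R) :
    (forall t : R, 0 < t -> is_derive t 1 f (df t)) ->
    f t @[t --> +oo] --> l ->
    df t - g t @[t --> +oo] --> (0 : R) ->
    lipschitz_on_pos K g ->
  g t @[t --> +oo] --> (0 : R).
Proof.
move=> fdf fl dfg gK; apply/cvgr0Pnorm_lt => eps eps0.
pose h := eps / (4 * (`|K| + 1)).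
have K1 : 0 < `|K| + 1 by rewrite ltr_wpDl.
have h0 : 0 < h by rewrite divr_gt0 // mulr_gt0.
have Kh : `|K| * h <= eps / 4.
  have -> : eps / 4 = (`|K| + 1) * h by rewrite /h; field; rewrite gt_eqF.
  by rewrite ler_wpM2r ?lerDl // ltW.
have eh0 : 0 < eps * h / 8 by rewrite divr_gt0 // mulr_gt0.
have e40 : 0 < eps / 4 by rewrite divr_gt0.
have /cvgrPdist_lt/(_ _ eh0) := fl.
have /cvgr0Pnorm_lt/(_ _ e40) := dfg.
move=> [M1 [_ HM1]] [M2 [_ HM2]].
near=> t.
have t0 : 0 < t by near: t; apply: nbhs_pinfty_gt; exact: num_real.
have tM1 : M1 < t by near: t; apply: nbhs_pinfty_gt; exact: num_real.
have tM2 : M2 < t by near: t; apply: nbhs_pinfty_gt; exact: num_real.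
have tth : t < t + h by rewrite ltrDl.
have [c /andP[tc cth] E] := MVT_pos fdf t0 tth.
have dfgc := HM1 _ (lt_trans tM1 tc).
have ft := HM2 _ tM2.
have fth := HM2 _ (lt_trans tM2 tth).
have gtc : `|g t - g c| <= eps / 4.
  apply: (le_trans (gK t c t0 (lt_trans t0 tc))); apply: le_trans Kh.
  rewrite (le_trans (ler_wpM2r (normr_ge0 _) (ler_norm K))) // ler_wpM2l //.
  by rewrite ler_norml; lra.
have dfc : `|df c| < eps / 4.
  rewrite -(ltr_pM2r h0) -[X in _ * X < _](gtr0_norm h0) -normrM.
  have -> : df c * h = (l - f t) - (l - f (t + h)).
    have -> : df c * h = f (t + h) - f t by rewrite E; ring.
    by ring.
  rewrite (le_lt_trans (ler_normB _ _)) //.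
  by rewrite (lt_le_trans (ltrD ft fth)) //; lra.
have -> : g t = (g t - g c) - (df c - g c) + df c by ring.
rewrite (le_lt_trans (ler_normD _ _)) //.
have := ler_normB (g t - g c) (df c - g c).
by move: dfgc gtc dfc; lra.
Unshelve. all: by end_near.
Qed.

Lemma cvg_ext (R : realType) (f g : R -> R) (a b : R) :
    f t @[t --> +oo] --> a -> f =1 g -> a = b ->
  g t @[t --> +oo] --> b.
Proof. by move=> + /funext <- <-. Qed.

Lemma cvg_pinfty_unique (R : realType) (f : R -> R) (a b : R) :
  f t @[t --> +oo] --> a -> f t @[t --> +oo] --> b -> a = b.
Proof. by move=> fa fb; exact: (cvg_unique (@norm_hausdorff _ R) fa fb). Qed.

(** If the limit of the squares is positive, then w has no zero near infinity
    and by the intermediate value theorem keeps a constant sign there, so it is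
    that sign times the converging function |w|. *)
Lemma cvg_of_sqr (R : realType) (w : R -> R) (a : R) :
    (forall t : R, 0 < t -> {for t, continuous w}) ->
    w t ^+ 2 @[t --> +oo] --> a ->
  exists l : R, w t @[t --> +oo] --> l.
Proof.
move=> wc w2a.
have normw : (`|w t| : R) @[t --> +oo] --> (Num.sqrt a : R).
  have -> : (fun t => `|w t|) = Num.sqrt \o (fun t => w t ^+ 2).
    by apply/funext => t /=; rewrite sqrtr_sqr.
  by apply: continuous_cvg => //; exact: sqrt_continuous.
have [sa0|sa_neq0] := eqVneq (Num.sqrt a) 0.
  by exists 0; apply/norm_cvg0P; rewrite -sa0.
have sa_gt0 : 0 < Num.sqrt a by rewrite lt0r sa_neq0 sqrtr_ge0.
have [M [_ wM]] : \forall t \near +oo, 0 < `|w t| by exact: (cvgr_gt _ normw).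
pose T := Num.max M 0 + 1.
have T0 : 0 < T by rewrite ltr_wpDl // le_max lexx orbT.
have TM : M < T by rewrite ltr_pwDr // le_max lexx.
have w_neq0 t : T <= t -> w t != 0.
  by move=> Tt; rewrite -normr_gt0; exact/wM/(lt_le_trans TM).
have same_sign t : T <= t -> 0 < w T * w t.
  move=> Tt; rewrite ltNge; apply/negP => wTt.
  have [||c] := @IVT R w T t 0 Tt.
  - apply: continuous_in_subspaceT => x /set_mem /=.
    by rewrite in_itv /= => /andP[Tx _]; exact/wc/(lt_le_trans T0).
  - move: wTt (w_neq0 T (lexx _)) (w_neq0 t Tt).
    by rewrite ge_min le_max; case: (ltrgt0P (w T)) => // wT; rewrite
      ?(pmulr_rle0 _ wT) ?(nmulr_rle0 _ wT) => -> //=; rewrite ?orbT.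
  by rewrite in_itv /= => /andP[Tc _] /eqP; rewrite (negPf (w_neq0 c Tc)).
exists (Num.sg (w T) * Num.sqrt a).
have sgw : Num.sg (w T) * `|w t| @[t --> +oo] --> Num.sg (w T) * Num.sqrt a.
  exact: cvgMl_tmp.
apply: cvg_trans sgw; apply: near_eq_cvg; near=> t.
have Tt : T <= t by near: t; apply: nbhs_pinfty_ge; exact: num_real.
have -> : Num.sg (w T) = Num.sg (w t).
  have := same_sign t Tt; rewrite -sgr_cp0 sgrM => /eqP wTt.
  by rewrite -[RHS]mul1r -wTt -mulrA -expr2 sqr_sg w_neq0 // mulr1.
by rewrite -numEsg.
Unshelve. all: by end_near.
Qed.

(** Barbalat's lemma applied to sin y and cos y, with the constants d L and
    - c L in the role of g, gives d L = 0 and c L = 0, while c^2 + d^2 = 1.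
    Thus y' is shown to vanish at infinity without proving that y converges. *)
Lemma trig_cvg_derive_cvg0 (R : realType) (y dy : R -> R) (c d L : R) :
    (forall t : R, 0 < t -> is_derive t 1 y (dy t)) ->
    sin (y t) @[t --> +oo] --> c -> cos (y t) @[t --> +oo] --> d ->
    dy t @[t --> +oo] --> L ->
  L = 0.
Proof.
move=> ydy siny cosy dyL.
have lip0 (a : R) : lipschitz_on_pos 0 (fun=> a).
  by move=> s t _ _; rewrite subrr normr0 mul0r.
have const0 (a : R) : a @[t --> (+oo : set_system R)] --> (0 : R) -> a = 0.
  by move=> a0; apply: cvg_pinfty_unique (cvg_cst a) a0.
have dL : d * L = 0.
  apply: const0; apply: (barbalat (f := sin \o y) (l := c)
    (df := fun t => cos (y t) * dy t) _ siny _ (lip0 _)) => [t t0|].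
    exact: is_derive1_comp (ydy t t0).
  by rewrite -(subrr (d * L)); apply: cvgB; [exact: cvgM | exact: cvg_cst].
have cL : - c * L = 0.
  apply: const0; apply: (barbalat (f := cos \o y) (l := d)
    (df := fun t => - sin (y t) * dy t) _ cosy _ (lip0 _)) => [t t0|].
    exact: is_derive1_comp (ydy t t0).
  rewrite -(subrr (- c * L)); apply: cvgB; last exact: cvg_cst.
  by apply: cvgM => //; exact: cvgN.
have cd1 : d ^+ 2 + c ^+ 2 = 1.
  apply: (cvg_pinfty_unique (f := fun=> 1)); last exact: cvg_cst.
  apply: (cvg_ext (cvgD (cvgM cosy cosy) (cvgM siny siny))) => // t.
  by rewrite /= -!expr2 cos2Dsin2.
(* Multiply L by d ^+ 2 + c ^+ 2 = 1. *)
have -> : L = d * (d * L) - c * (- c * L) by rewrite -[LHS]mul1r -cd1; ring.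
by rewrite dL cL !mulr0 subrr.
Qed.

Lemma sin_sub_cvg0 (R : realType) (u v : R -> R) :
    u t - v t @[t --> +oo] --> (0 : R) ->
  sin (u t) - sin (v t) @[t --> +oo] --> (0 : R).
Proof.
move=> /cvgr0Pnorm_lt uv; apply/cvgr0Pnorm_lt => eps /uv.
by apply: filterS => t; apply: le_lt_trans; exact: sin_lipschitz.
Qed.

(** * Velocities of synchronized clusters *)

Definition velocity (R : realType) (n : nat) (e : rel 'I_n) (alpha : R)
    (theta : 'I_n -> R -> R) (i : 'I_n) (t : R) : R :=
  \sum_(j < n) adjacency R e i j * sin (theta j t - theta i t - alpha).

Definition synchronized (R : realType) (n : nat) (theta : 'I_n -> R -> R)
    (S : {set 'I_n}) : Prop :=
  forall i j : 'I_n, i \in S -> j \in S ->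
    theta i t - theta j t @[t --> +oo] --> (0 : R).

(** The velocity that vertex i of S would have if S and its complement were
    both exactly in phase and y were the phase of the complement minus the
    phase of S minus alpha. *)
Definition cluster_velocity (R : realType) (n : nat) (e : rel 'I_n) (alpha : R)
    (S : {set 'I_n}) (i : 'I_n) (y : R) : R :=
  - (nb_neighbours e i S)%:R * sin alpha
  + (nb_neighbours e i (~: S)%SET)%:R * sin y.

Lemma nb_neighbours_sum (R : realType) (T : finType) (e : rel T) (x : T)
    (S : {set T}) :
  (nb_neighbours e x S)%:R = \sum_(y in S) (e x y)%:R :> R.
Proof.
rewrite /nb_neighbours -sum1_card natr_sum big_mkcond [RHS]big_mkcond /=.
by apply: eq_bigr => y _; rewrite inE; case: (y \in S); case: (e x y).
Qed.

Lemma velocity_bounded (R : realType) (n : nat) (e : rel 'I_n) (alpha : R)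
    (theta : 'I_n -> R -> R) (i : 'I_n) (t : R) :
  `|velocity e alpha theta i t| <= n%:R.
Proof.
rewrite (le_trans (ler_norm_sum _ _ _)) //.
rewrite -[n in n%:R]card_ord -sum1_card natr_sum ler_sum // => j _.
rewrite mxE normrM normr_nat; case: (e i j); rewrite ?mul0r ?mul1r //.
by rewrite ler_norml sin_geN1 sin_le1.
Qed.

(** Replacing each phase by that of the representative of its part, p or q,
    changes the argument of every sine by a quantity tending to 0. *)
Lemma velocity_cluster (R : realType) (n : nat) (e : rel 'I_n) (alpha : R)
    (theta : 'I_n -> R -> R) (S : {set 'I_n}) (p q i : 'I_n) :
    synchronized theta S -> synchronized theta (~: S)%SET ->
    p \in S -> q \in (~: S)%SET -> i \in S ->
  velocity e alpha theta i t
    - cluster_velocity e alpha S i (theta q t - theta p t - alpha)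
      @[t --> +oo] --> (0 : R).
Proof.
move=> syncS syncC pS qS iS.
pose r (j : 'I_n) := if j \in S then p else q.
have -> : (fun t => velocity e alpha theta i t
    - cluster_velocity e alpha S i (theta q t - theta p t - alpha)) =
  (fun t => \sum_(j < n) (e i j)%:R * (sin (theta j t - theta i t - alpha)
             - sin (theta (r j) t - theta p t - alpha))).
  apply/funext => t; under [RHS]eq_bigr do rewrite mulrBr.
  rewrite sumrB; congr (_ - _); first by apply: eq_bigr => j _; rewrite mxE.
  rewrite /cluster_velocity !nb_neighbours_sum [RHS](bigID (mem S)) /=.
  congr (_ + _).
    rewrite mulNr -mulrN -sinN mulr_suml; apply: eq_bigr => j jS.
    by rewrite /r jS subrr sub0r.
  rewrite mulr_suml; apply: eq_big => j; first by rewrite inE.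
  by rewrite inE => /negPf jS; rewrite /r jS.
rewrite [X in _ --> X](_ : 0 = \sum_(j < n) 0); last by rewrite big1.
apply: cvg_big => [|j _]; first exact: add_continuous.
rewrite -(mulr0 (e i j)%:R); apply: cvgMl_tmp; apply: sin_sub_cvg0.
have -> : (fun t => theta j t - theta i t - alpha
                    - (theta (r j) t - theta p t - alpha)) =
    (fun t => theta j t - theta (r j) t) \- (fun t => theta i t - theta p t).
  by apply/funext => t /=; ring.
rewrite -(subr0 (0 : R)); apply: cvgB; last exact: syncS.
rewrite /r; case: ifPn => jS; first exact: syncS.
by apply: syncC => //; rewrite inE.
Qed.

Lemma solution_is_derive (R : realType) (n : nat) (e : rel 'I_n) (alpha : R)
    (theta : 'I_n -> R -> R) (i : 'I_n) (t : R) :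
    frustrated_kuramoto_solution e alpha theta -> 0 < t ->
  is_derive t 1 (theta i) (velocity e alpha theta i t).
Proof. by move=> /(_ i)[+ _]; exact. Qed.

Lemma phase_gap_is_derive (R : realType) (n : nat) (e : rel 'I_n) (alpha : R)
    (theta : 'I_n -> R -> R) (p q : 'I_n) (t : R) :
    frustrated_kuramoto_solution e alpha theta -> 0 < t ->
  is_derive t 1 (fun t => theta q t - theta p t - alpha)
    (velocity e alpha theta q t - velocity e alpha theta p t).
Proof.
move=> sol t0; rewrite -[X in is_derive _ _ _ X]subr0.
apply: is_deriveB; apply: is_deriveB; exact: solution_is_derive.
Qed.

(** Velocities are bounded by n, so a difference of two phases moves at speed
    at most 2 n. *)
Lemma sin_phase_gap_lipschitz (R : realType) (n : nat) (e : rel 'I_n)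
    (alpha : R) (theta : 'I_n -> R -> R) (p q : 'I_n) :
    frustrated_kuramoto_solution e alpha theta ->
  lipschitz_on_pos (n%:R + n%:R) (fun t => sin (theta q t - theta p t - alpha)).
Proof.
move=> sol s t s0 t0; apply: (le_trans (sin_lipschitz _ _)).
apply: (bounded_derive_lipschitz (f := fun t => theta q t - theta p t - alpha)
  (df := velocity e alpha theta q \- velocity e alpha theta p)) => //.
  by move=> x x0; exact: phase_gap_is_derive.
by move=> x; rewrite (le_trans (ler_normB _ _)) // lerD ?velocity_bounded.
Qed.

(** Barbalat's lemma for theta i - theta j, whose derivative is asymptotic to
    this gap by [velocity_cluster]; the constants cancel in the gap, which
    leaves a multiple of the Lipschitz function sin y. *)
Lemma cluster_velocity_gap_cvg0 (R : realType) (n : nat) (e : rel 'I_n)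
    (alpha : R) (theta : 'I_n -> R -> R) (S : {set 'I_n}) (p q i j : 'I_n) :
    frustrated_kuramoto_solution e alpha theta ->
    synchronized theta S -> synchronized theta (~: S)%SET ->
    p \in S -> q \in (~: S)%SET -> i \in S -> j \in S ->
  let y t := theta q t - theta p t - alpha in
  cluster_velocity e alpha S i (y t) - cluster_velocity e alpha S j (y t)
    @[t --> +oo] --> (0 : R).
Proof.
move=> sol syncS syncC pS qS iS jS y.
pose c : R := (nb_neighbours e i (~: S)%SET)%:R
            - (nb_neighbours e j (~: S)%SET)%:R.
apply: (@barbalat _ (fun t => theta i t - theta j t)
  (fun t => velocity e alpha theta i t - velocity e alpha theta j t) _
  (`|c| * (n%:R + n%:R)) 0).
- by move=> t t0; apply: is_deriveB; exact: solution_is_derive.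
- exact: syncS.
- apply: (cvg_ext (cvgB (velocity_cluster e alpha syncS syncC pS qS iS)
                       (velocity_cluster e alpha syncS syncC pS qS jS))).
    by move=> t; rewrite !fctE /y; ring.
  by rewrite subr0.
- move=> s t s0 t0.
  have -> : cluster_velocity e alpha S i (y s)
      - cluster_velocity e alpha S j (y s)
      - (cluster_velocity e alpha S i (y t)
         - cluster_velocity e alpha S j (y t)) = c * (sin (y s) - sin (y t)).
    by rewrite /cluster_velocity /c; ring.
  rewrite normrM -mulrA ler_wpM2l //.
  exact: (sin_phase_gap_lipschitz _ _ sol s0 t0).
Qed.

(** * Relations between the degrees *)

(** Writing the limit of sin y as m sin alpha lets sin alpha be cancelled from
    the limit of [cluster_velocity_gap_cvg0]. *)
Lemma degree_relation (R : realType) (n : nat) (e : rel 'I_n) (alpha m : R)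
    (theta : 'I_n -> R -> R) (S : {set 'I_n}) (p q : 'I_n) :
    frustrated_kuramoto_solution e alpha theta ->
    synchronized theta S -> synchronized theta (~: S)%SET ->
    p \in S -> q \in (~: S)%SET -> sin alpha != 0 ->
    sin (theta q t - theta p t - alpha) @[t --> +oo] --> m * sin alpha ->
  forall i, i \in S ->
    - (nb_neighbours e i S)%:R + m * (nb_neighbours e i (~: S)%SET)%:R
    = - (nb_neighbours e p S)%:R + m * (nb_neighbours e p (~: S)%SET)%:R :> R.
Proof.
move=> sol syncS syncC pS qS sa0 siny i iS.
have gap := cluster_velocity_gap_cvg0 sol syncS syncC pS qS iS pS.
have cv j : cluster_velocity e alpha S j (theta q t - theta p t - alpha)
    @[t --> +oo] --> (- (nb_neighbours e j S)%:R
                  + m * (nb_neighbours e j (~: S)%SET)%:R) * sin alpha.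
  rewrite mulrDl [m * _]mulrC -mulrA.
  by apply: cvgD; [exact: cvg_cst | exact: cvgMl_tmp].
apply: (mulIf sa0); apply/subr0_eq.
exact: (cvg_pinfty_unique (cvgB (cv i) (cv p)) gap).
Qed.

(** Two vertices of S with different cross-degrees force sin y to converge.
    Through cos y this also fixes the limit of the sine of the opposite gap, so
    both parts obey a linear relation; the two constants agree because the
    clusters cannot drift apart when sin y and cos y converge. *)
Lemma unequal_cross_degrees_relation (R : realType) (n : nat) (e : rel 'I_n)
    (alpha : R) (theta : 'I_n -> R -> R) (S : {set 'I_n}) (q i j : 'I_n) :
    frustrated_kuramoto_solution e alpha theta -> sin alpha != 0 ->
    synchronized theta S -> synchronized theta (~: S)%SET ->
    q \in (~: S)%SET -> i \in S -> j \in S ->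
    nb_neighbours e i (~: S)%SET <> nb_neighbours e j (~: S)%SET ->
  exists mu1 mu2 r : R,
    (forall v, v \in S ->
      - (nb_neighbours e v S)%:R + mu1 * (nb_neighbours e v (~: S)%SET)%:R
      = r) /\
    (forall v, v \in (~: S)%SET ->
      - (nb_neighbours e v (~: S)%SET)%:R + mu2 * (nb_neighbours e v S)%:R
      = r).
Proof.
move=> sol sa0 syncS syncC qC iS jS neq.
pose y t := theta q t - theta i t - alpha.
pose dS (v : 'I_n) : R := (nb_neighbours e v S)%:R.
pose dC (v : 'I_n) : R := (nb_neighbours e v (~: S)%SET)%:R.
pose c := (dS i - dS j) * sin alpha / (dC i - dC j).
have dC_neq : dC i - dC j != 0.
  by rewrite subr_eq0 eqr_nat; apply/eqP.
have siny : sin (y t) @[t --> +oo] --> c.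
  have gap := cluster_velocity_gap_cvg0 sol syncS syncC iS qC iS jS.
  apply: (cvg_ext (cvgD (cvg_cst c) (cvgMl_tmp (a := (dC i - dC j)^-1) gap))).
    move=> t; rewrite ?fctE /= /cluster_velocity.
    by rewrite /c /y /dS /dC; field; exact: dC_neq.
  by rewrite mulr0 addr0.
have y_der (t : R) : 0 < t -> is_derive t 1 y
    (velocity e alpha theta q t - velocity e alpha theta i t).
  by move=> t0; exact: phase_gap_is_derive.
have [d cosy] : exists d : R, cos (y t) @[t --> +oo] --> d.
  apply: (@cvg_of_sqr _ _ (1 - c ^+ 2)) => [t t0|].
    apply: continuous_comp; last exact: continuous_cos.
    exact/is_derive_continuous/y_der.
  apply: (cvg_ext (cvgB (cvg_cst (1 : R)) (cvgM siny siny))) => // t.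
  by rewrite ?fctE /= -expr2 -(cos2Dsin2 (y t)); ring.
(* The opposite gap is - y - 2 alpha, and this is minus the addition formula
   for sin (y + 2 alpha) in the limit. *)
pose c2 := - (c * cos (alpha + alpha) + d * sin (alpha + alpha)).
have sinz : sin (theta i t - theta q t - alpha) @[t --> +oo] --> c2.
  apply: (cvg_ext (cvgN (cvgD (cvgMr_tmp (b := cos (alpha + alpha)) siny)
                     (cvgMr_tmp (b := sin (alpha + alpha)) cosy)))) => // t.
  by rewrite ?fctE /= -sinD -sinN; congr sin; rewrite /y; ring.
pose mu1 := c / sin alpha; pose mu2 := c2 / sin alpha.
have mu1E : mu1 * sin alpha = c by rewrite /mu1 divfK.
have mu2E : mu2 * sin alpha = c2 by rewrite /mu2 divfK.
have syncCC : synchronized theta (~: ~: S)%SET by rewrite finset.setCK.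
have iCC : i \in (~: ~: S)%SET by rewrite finset.setCK.
have velq := velocity_cluster e alpha syncC syncCC qC iCC qC.
have veli := velocity_cluster e alpha syncS syncC iS qC iS.
rewrite -mu1E in siny; rewrite -mu2E in sinz.
have rel1 := degree_relation sol syncS syncC iS qC sa0 siny.
have rel2 := degree_relation sol syncC syncCC qC iCC sa0 sinz.
rewrite finset.setCK in rel2.
pose r1 := - dS i + mu1 * dC i; pose r2 := - dC q + mu2 * dS q.
have veli_lim : velocity e alpha theta i t @[t --> +oo] --> r1 * sin alpha.
  apply: (cvg_ext (cvgD veli (cvgD (cvg_cst (- dS i * sin alpha))
                                   (cvgMl_tmp (a := dC i) siny)))).
    by move=> t; rewrite ?fctE /= /cluster_velocity; ring.
  by rewrite /r1; ring.
have velq_lim : velocity e alpha theta q t @[t --> +oo] --> r2 * sin alpha.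
  apply: (cvg_ext (cvgD velq (cvgD (cvg_cst (- dC q * sin alpha))
                                   (cvgMl_tmp (a := dS q) sinz)))).
    by move=> t; rewrite ?fctE /= /cluster_velocity finset.setCK; ring.
  by rewrite /r2; ring.
have r21 : r2 = r1.
  apply: (mulIf sa0); apply/subr0_eq.
  exact: (trig_cvg_derive_cvg0 y_der siny cosy (cvgB velq_lim veli_lim)).
exists mu1, mu2, r1; split=> // v vC.
by rewrite -r21; exact: rel2.
Qed.

(** With equal cross-degrees the gap of [cluster_velocity_gap_cvg0] is the
    constant (d_S(j) - d_S(i)) sin alpha, and a constant tending to 0 is 0. *)
Lemma equal_cross_degrees (R : realType) (n : nat) (e : rel 'I_n)
    (alpha : R) (theta : 'I_n -> R -> R) (S : {set 'I_n}) (q i j : 'I_n) :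
    frustrated_kuramoto_solution e alpha theta -> sin alpha != 0 ->
    synchronized theta S -> synchronized theta (~: S)%SET ->
    q \in (~: S)%SET -> i \in S -> j \in S ->
    nb_neighbours e i (~: S)%SET = nb_neighbours e j (~: S)%SET ->
  nb_neighbours e i S = nb_neighbours e j S.
Proof.
move=> sol sa0 syncS syncC qC iS jS eqC.
have gap := cluster_velocity_gap_cvg0 sol syncS syncC iS qC iS jS.
have E t : cluster_velocity e alpha S i (theta q t - theta i t - alpha)
    - cluster_velocity e alpha S j (theta q t - theta i t - alpha)
  = ((nb_neighbours e j S)%:R - (nb_neighbours e i S)%:R) * sin alpha.
  by rewrite /cluster_velocity eqC; ring.
apply/eqP; rewrite eq_sym -(eqr_nat R); apply/eqP/(mulIf sa0)/subr0_eq.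
rewrite -mulrBl; apply: (cvg_pinfty_unique _ (cvg_ext gap E erefl)).
exact: cvg_cst.
Qed.

Lemma partition_setC (T : finType) (S : {set T}) (x y : T) :
  x \in S -> y \in (~: S)%SET -> finset.partition [set S; ~: S]%SET [set: T].
Proof.
move=> xS yC; apply/and3P; split.
- rewrite -finset.subTset; apply/fintype.subsetP => v _.
  apply/finset.bigcupP; case: (boolP (v \in S)) => vS.
    by exists S; rewrite // !inE eqxx.
  by exists (~: S)%SET; rewrite !inE // eqxx orbT.
- apply/finset.trivIsetP => A B; rewrite !inE => /orP[]/eqP-> /orP[]/eqP->;
    by rewrite ?eqxx // -setI_eq0 ?finset.setICr // finset.setIC finset.setICr.
- rewrite !inE negb_or !(eq_sym finset.set0); apply/andP; split.
    by apply/finset.set0Pn; exists x.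
  by apply/finset.set0Pn; exists y.
Qed.

Theorem theorem11 (R : realType) (n k : nat) (e : rel 'I_n)
    (alpha : R) (theta : 'I_n -> R -> R)
    (graph_e : simple_graph e) (connected_e : connected_graph e)
    (k_ge1 : (1 <= k)%N) (k_le : (k <= n - 1)%N)
    (alpha_gt0 : 0 < alpha) (alpha_lt : alpha < pi / 2)
    (theta_sol : frustrated_kuramoto_solution e alpha theta)
    (sync1 : forall i j : 'I_n, i \in first_part n k -> j \in first_part n k ->
       theta i t - theta j t @[t --> +oo] --> (0 : R))
    (sync2 : forall p q : 'I_n, p \in second_part n k -> q \in second_part n k ->
       theta p t - theta q t @[t --> +oo] --> (0 : R))
    (not_sync : exists i p : 'I_n,
       [/\ i \in first_part n k, p \in second_part n k &
           ~ (theta i t - theta p t @[t --> +oo] --> (0 : R))]) :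
  let delta1 (i : 'I_n) : R := (nb_neighbours e i (first_part n k))%:R in
  let delta2 (i : 'I_n) : R := (nb_neighbours e i (second_part n k))%:R in
  equitable_partition e [set first_part n k; second_part n k]%SET \/
  exists mu1 mu2 r : R,
    (forall i : 'I_n, i \in first_part n k -> - delta1 i + mu1 * delta2 i = r) /\
    (forall j : 'I_n, j \in second_part n k -> - delta2 j + mu2 * delta1 j = r).
Proof.
move=> delta1 delta2; rewrite /delta1 /delta2 {delta1 delta2}.
have [p [q [pS qC _]]] := not_sync.
have sa0 : sin alpha != 0 by rewrite gt_eqF // sin_gt0_pihalf // alpha_gt0.
have partC : second_part n k = (~: first_part n k)%SET.
  by apply/setP => i; rewrite !inE leqNgt.
rewrite partC in sync2 qC *; set S := first_part n k in sync1 sync2 pS qC *.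
have syncCC : synchronized theta (~: ~: S)%SET by rewrite finset.setCK.
have pCC : p \in (~: ~: S)%SET by rewrite finset.setCK.
have [[i [j [iS jS neq]]]|eqS] := pselect (exists i j, [/\ i \in S, j \in S &
    nb_neighbours e i (~: S)%SET <> nb_neighbours e j (~: S)%SET]).
  right; exact: (unequal_cross_degrees_relation theta_sol sa0 sync1 sync2
    qC iS jS neq).
have [[i [j [iC jC neq]]]|eqC] := pselect (exists i j, [/\ i \in (~: S)%SET,
    j \in (~: S)%SET & nb_neighbours e i S <> nb_neighbours e j S]).
  have [|mu1 [mu2 [r []]]] := unequal_cross_degrees_relation theta_sol sa0
    sync2 syncCC pCC iC jC; rewrite finset.setCK // => rel1 rel2.
  by right; exists mu2, mu1, r.
left; split; first exact: partition_setC pS qC.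
have crossS i j : i \in S -> j \in S ->
    nb_neighbours e i (~: S)%SET = nb_neighbours e j (~: S)%SET.
  by move=> iS jS; apply: contrapT => neq; apply: eqS; exists i, j.
have crossC i j : i \in (~: S)%SET -> j \in (~: S)%SET ->
    nb_neighbours e i S = nb_neighbours e j S.
  by move=> iC jC; apply: contrapT => neq; apply: eqC; exists i, j.
move=> A B; rewrite !inE => /orP[]/eqP-> /orP[]/eqP-> i j iA jA.
- apply: (equal_cross_degrees theta_sol sa0 sync1 sync2 qC iA jA).
  exact: crossS.
- exact: crossS.
- exact: crossC.
- apply: (equal_cross_degrees theta_sol sa0 sync2 syncCC pCC iA jA).
  by rewrite finset.setCK; exact: crossC.
Qed.
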